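(* For each positive integer $m$, there is a planar graph $G$ which is not $\left(4m+\left\lfloor \frac{2m-1}{9}\right\rfloor,\, m\right)$-choosable.
   Context: All graphs are finite and simple. For a graph $G$ and positive integers $a,b$: a $b$-fold colouring of $G$ is a map $\phi$ assigning to each vertex $v$ a set $\phi(v)$ of $b$ colours such that adjacent vertices receive disjoint sets. An $a$-list assignment of $G$ is a map $L$ assigning to each vertex $v$ a set $L(v)$ of exactly $a$ colours. A $b$-fold $L$-colouring is a $b$-fold colouring $\phi$ with $\phi(v)\subseteq L(v)$ for every vertex $v$. $G$ is $(a,b)$-choosable if for every $a$-list assignment $L$ of $G$ there exists a $b$-fold $L$-colouring of $G$. *)

(* Defs.v *)
From HB Require Import structures.
From mathcomp Require Import all_boot all_order all_algebra finmap.
From mathcomp Require Import all_classical all_reals all_analysis.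

Set Implicit Arguments.
Unset Strict Implicit.
Unset Printing Implicit Defensive.

Import Order.TTheory GRing.Theory Num.Theory.
Import numFieldNormedType.Exports.

Record sgraph := SGraph {
  vertex :> finType;
  adj : rel vertex;
  adj_sym : symmetric adj;
  adj_irrefl : irreflexive adj
}.

Section MultipleListColouring.
Variables (G : sgraph) (C : choiceType).
Local Open Scope fset_scope.

Definition fold_colouring (b : nat) (phi : G -> {fset C}) : Prop :=
  (forall v, #|` phi v| = b) /\
  (forall u v, adj u v -> [disjoint phi u & phi v]).

Definition list_assignment (a : nat) (L : G -> {fset C}) : Prop :=
  forall v, #|` L v| = a.

Definition fold_list_colouring (b : nat) (L phi : G -> {fset C}) : Prop :=
  fold_colouring b phi /\ forall v, phi v `<=` L v.

End MultipleListColouring.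

Definition choosable (G : sgraph) (a b : nat) : Prop :=
  forall (C : choiceType) (L : G -> {fset C}),
    list_assignment a L -> exists phi, fold_list_colouring b L phi.

Section Planarity.
Variable R : realType.
Local Open Scope classical_set_scope.
Local Open Scope ring_scope.

Definition arc_between (A : set (R * R)) (x y : R * R) : Prop :=
  exists g : R -> R * R,
    [/\ {within `[0, 1], continuous g},
        {in `[0, 1] &, injective g},
        g 0 = x, g 1 = y & g @` `[0, 1] = A].

(* [arc E] is the curve drawn for the edge with end set [E]; its values on
   sets that are not of the form [set u; v] with [adj u v] are irrelevant. *)
Definition plane_drawing (G : sgraph) (pos : G -> R * R)
    (arc : {set G} -> set (R * R)) : Prop :=
  [/\ injective pos,
      forall u v : G, adj u v -> arc_between (arc [set u; v]%SET) (pos u) (pos v),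
      forall u v w : G, adj u v -> arc [set u; v]%SET (pos w) -> w = u \/ w = v
    & forall u v x y : G, adj u v -> adj x y ->
        [set u; v]%SET <> [set x; y]%SET ->
        arc [set u; v]%SET `&` arc [set x; y]%SET `<=` range pos].

Definition planar (G : sgraph) : Prop :=
  exists pos arc, @plane_drawing G pos arc.

End Planarity.

(* Main.v *)
Require Import Defs.
From HB Require Import structures.
From mathcomp Require Import all_boot all_order all_algebra finmap.
From mathcomp Require Import all_classical all_reals all_analysis.
From mathcomp Require Import zify ring lra.

(* Write k for the excess 4m + k of the list size; 3k < m is all that is needed.
   Two poles get disjoint lists U and V. For every pair (A, B) of m-subsets of U
   and V, a piece of the graph between the poles is uncolourable once the poles
   are coloured A and B. The middle vertex w of the piece, adjacent to both poles, gets the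
   list A, B, W with |W| = 2m + k, so it is coloured by some P inside W. On
   either side of w there is a triangle x, y, z, where x sees both poles, y sees w
   and the pole B, and z sees w and the pole A; after removing A and B their lists
   are E, D for x and W, E for y and z, where |E| = m, D is inside W and
   |D| = m + k. As y and z use 2m of the 2m + k colours of E and W \ P, at least
   m - k colours of x lie in the intersection of P and D. Taking for D on the two
   sides two sets D1, D2 that cover W and share k colours forces
   2 (m - k) <= |P| + |D1 n D2| = m + k, hence m <= 3k. *)

Set Implicit Arguments.
Unset Strict Implicit.
Unset Printing Implicit Defensive.

Import Order.TTheory GRing.Theory Num.Theory.
Import numFieldNormedType.Exports.

(** * The strip graph and the orientation of its edges *)

(* [inl b] are the two poles. Block [i] consists of [inr (i, None)], adjacent to
   both poles, followed by the adjacent pair [inr (i, Some b)], each adjacent to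
   the pole [b]; both members of the pair are also adjacent to [inr (i, None)]
   and [inr (i + 1, None)]. *)
Definition strip_vertex (n : nat) : finType := (bool + 'I_n * option bool)%type.

Definition strip_arrow n : rel (strip_vertex n) := fun p q =>
  match p, q with
  | inl _, inr (_, None) => true
  | inl b, inr (_, Some c) => b == c
  | inr (i, None), inr (j, Some _) => i == j :> nat
  | inr (i, Some _), inr (j, None) => j == i.+1 :> nat
  | inr (i, Some true), inr (j, Some false) => i == j :> nat
  | _, _ => false
  end.

Definition strip_adj n : rel (strip_vertex n) :=
  fun p q => strip_arrow p q || strip_arrow q p.

Lemma strip_adj_sym n : symmetric (@strip_adj n).
Proof. by move=> p q; rewrite /strip_adj orbC. Qed.

Lemma strip_adj_irrefl n : irreflexive (@strip_adj n).
Proof. by rewrite /strip_adj => -[b|[i [[]|]]]. Qed.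

Definition strip n : sgraph := SGraph (@strip_adj_sym n) (@strip_adj_irrefl n).

Lemma strip_arrow_asym n (p q : strip n) : strip_arrow p q -> ~~ strip_arrow q p.
Proof.
case: p q => [b|[i [[]|]]] [c|[j [[]|]]] //=.
all: lia.
Qed.

(** An edge carries only one of its two orientations, so its end set determines the directed path
    that draws it. *)
Lemma strip_arrow_inj n (p q x y : strip n) :
  strip_arrow p q -> strip_arrow x y ->
  [set p; q]%SET = [set x; y]%SET -> p = x /\ q = y.
Proof.
move=> pq xy E.
have := set21 p q; rewrite E => /set2P px.
have := set22 p q; rewrite E => /set2P qx.
have := strip_arrow_asym xy.
have npp (z : strip n) : ~ strip_arrow z z.
  by move=> zz; have := strip_arrow_asym zz; rewrite zz.
move: pq; case: px qx => -> [] -> pq //; last by case: (npp _ pq).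
  by case: (npp _ pq).
by have := strip_arrow_asym xy; rewrite pq.
Qed.

(** * A plane drawing of the strip *)

Section Drawing.
Variables (R : realType) (n : nat).
Local Open Scope classical_set_scope.
Local Open Scope ring_scope.
Implicit Types p q x y w : strip n.

(* Collapses the sides [h = 1] and [h = -1] of a horizontal strip to the two
   poles and is injective in between; edges are drawn as images of segments. *)
Definition pinch (s h : R) : R * R := (s * (1 - h ^+ 2), h).

Definition pole (b : bool) : R := if b then 1 else -1.

Definition height p : R :=
  match p with
  | inl b => pole b
  | inr (_, None) => 0
  | inr (_, Some b) => pole b / 2
  end.

(** Doubling leaves an odd column for the pair between two middle vertices. The value at a pole is
    arbitrary, since [pinch] sends all abscissas to 0 at heights 1 and -1. *)
Definition column p : nat :=
  match p with
  | inl _ => 0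
  | inr (i, None) => i.*2
  | inr (i, Some _) => i.*2.+1
  end.

Definition strip_pos p : R * R := pinch (column p)%:R (height p).

(* An edge leaving a pole is vertical in the strip, so it starts in the column of
   its other end. *)
Definition tail_column p q : nat := if p is inl _ then column q else column p.

Definition edge_abscissa p q (t : R) : R :=
  (tail_column p q)%:R * (1 - t) + (column q)%:R * t.

Definition edge_height p q (t : R) : R := height p * (1 - t) + height q * t.

Definition edge_path p q (t : R) : R * R :=
  pinch (edge_abscissa p q t) (edge_height p q t).

Definition strip_arc (S : {set strip n}) : set (R * R) :=
  [set P | exists p q, [/\ strip_arrow p q, S = [set p; q]%SET
                         & (edge_path p q @` `[0, 1]) P]].

Lemma nat_cell_inj (a b : nat) (s : R) :
  a%:R <= s < a%:R + 1 -> b%:R <= s < b%:R + 1 -> a = b.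
Proof.
move=> /andP[h1 h2] /andP[h3 h4].
have : a%:R < b.+1%:R :> R by rewrite -natr1; lra.
have : b%:R < a.+1%:R :> R by rewrite -natr1; lra.
rewrite !ltr_nat; lia.
Qed.

Lemma height_le1 p : -1 <= height p <= 1.
Proof. case: p => [[]|[i [[]|]]] /=; lra. Qed.

Lemma pinch_inj (s s' h h' : R) : -1 < h < 1 ->
  pinch s h = pinch s' h' -> s = s' /\ h = h'.
Proof.
move=> hh [E Eh]; subst h'; split=> //.
have h2 : 1 - h ^+ 2 != 0 by apply/eqP => ?; nra.
exact: mulIf h2 _ _ E.
Qed.

Lemma strip_pos_inj : injective strip_pos.
Proof.
move=> p q E; have [_ Eh] := E.
(* Only the poles lie on the sides of the strip, and their heights differ; elsewhere [pinch] can be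
   inverted. *)
have [hp|hp] := boolP (-1 < height p < 1); last first.
  move: hp Eh {E}.
  case: p q => [[]|[i [[]|]]] [[]|[j [[]|]]] //= hp Eh; exfalso; lra.
have [/eqP] := pinch_inj hp E; rewrite eqr_nat => /eqP Ec _.
move: hp Ec Eh {E}.
case: p q => [[]|[i [[]|]]] [[]|[j [[]|]]] //= hp Ec Eh;
  try by [exfalso; lra|exfalso; lia].
all: by congr (inr (_, _)); apply: val_inj => /=; lia.
Qed.

Lemma edge_path0 p q : edge_path p q 0 = strip_pos p.
Proof.
rewrite /edge_path /strip_pos /edge_abscissa /edge_height /tail_column.
rewrite subr0 !mulr1 !mulr0 !addr0 /pinch.
by case: p => [[]|p] //=; congr pair; ring.
Qed.

Lemma edge_path1 p q : edge_path p q 1 = strip_pos q.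
Proof.
rewrite /edge_path /strip_pos /edge_abscissa /edge_height.
by rewrite subrr !mulr1 !mulr0 !add0r.
Qed.

Lemma arrow_height p q : strip_arrow p q -> height p != height q.
Proof.
case: p q => [[]|[i [[]|]]] [[]|[j [[]|]]] //= _; apply/eqP; lra.
Qed.

(** The height alone separates the points: it is affine in [t] with nonzero slope. *)
Lemma edge_path_inj p q : strip_arrow p q -> injective (edge_path p q).
Proof.
move=> /arrow_height pq t t' [_]; rewrite /edge_height => E.
have : (height q - height p) * t = (height q - height p) * t' by lra.
by apply: mulfI; rewrite subr_eq0 eq_sym.
Qed.

Lemma affine_continuous (a b : R) : continuous (fun t : R => a * (1 - t) + b * t).
Proof.
move=> t; apply: cvgD; apply: cvgMr; last exact: cvg_id.
by apply: cvgB; [exact: cvg_cst|exact: cvg_id].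
Qed.

Lemma edge_path_continuous p q : continuous (edge_path p q).
Proof.
move=> t.
have hc : edge_height p q u @[u --> t] --> edge_height p q t.
  exact: affine_continuous.
apply: (@cvg_pair R R R (nbhs t)
  (nbhs (edge_abscissa p q t * (1 - edge_height p q t ^+ 2)))
  (nbhs (edge_height p q t))) => //.
apply: cvgM; first exact: affine_continuous.
by apply: cvgB; [exact: cvg_cst|exact: cvgM].
Qed.

Lemma arc_between_path (g : R -> R * R) : continuous g -> injective g ->
  arc_between (g @` `[0, 1]) (g 0) (g 1).
Proof.
move=> gc gi; exists g; split=> //; first exact: continuous_subspaceT.
by move=> ? ? _ _ /gi.
Qed.

Lemma arc_between_path_rev (g : R -> R * R) : continuous g -> injective g ->
  arc_between (g @` `[0, 1]) (g 1) (g 0).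
Proof.
move=> gc gi; pose r (t : R) := 1 - t.
have rc : continuous r by move=> t; apply: cvgB; [exact: cvg_cst|exact: cvg_id].
have grc : continuous (g \o r) by move=> t; apply: continuous_comp; [exact: rc|exact: gc].
have gri : injective (g \o r) by move=> t t' /gi; rewrite /r; lra.
have := arc_between_path grc gri; rewrite /r /= subr0 subrr.
suff -> : (g \o r) @` `[0, 1] = g @` `[0, 1] by [].
apply/seteqP; split=> P [t]; rewrite /= in_itv /= => t01 <-.
  by exists (r t) => //; rewrite /= in_itv /= /r; lra.
by exists (r t); [rewrite /= in_itv /= /r; lra|rewrite /= /r; congr g; ring].
Qed.

Lemma strip_arcE p q : strip_arrow p q ->
  strip_arc [set p; q]%SET = edge_path p q @` `[0, 1].
Proof.
move=> pq; apply/seteqP; split=> [P [x [y [xy E]]]|P PA].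
  by have [-> ->] := strip_arrow_inj pq xy E.
by exists p, q.
Qed.

(** * Interiors of edges avoid each other and the vertices *)

Definition edge_slanted p q := tail_column p q != column q.

Definition edge_column p q := minn (tail_column p q) (column q).

(** In the strip an edge stays in one column or moves to a neighbouring one, so [edge_column] is the
    integer part of the abscissa throughout its interior. *)
Lemma open_edge_abscissa p q (t : R) : strip_arrow p q -> 0 < t < 1 ->
  if edge_slanted p q
  then (edge_column p q)%:R < edge_abscissa p q t < (edge_column p q)%:R + 1
  else edge_abscissa p q t == (edge_column p q)%:R.
Proof.
rewrite /edge_slanted /edge_column /edge_abscissa.
have slanted (c d : nat) (e : d = c.+1 \/ c = d.+1) : 0 < t < 1 ->
  if c != d then (minn c d)%:R < c%:R * (1 - t) + d%:R * t < (minn c d)%:R + 1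
  else c%:R * (1 - t) + d%:R * t == (minn c d)%:R.
  move=> t01; case: e => ->.
    rewrite ifT; last by lia.
    by rewrite (minn_idPl _) ?leqnSn // -natr1; nra.
  rewrite ifT; last by lia.
  by rewrite (minn_idPr _) ?leqnSn // -natr1; nra.
have vertical (c : nat) :
  if c != c then (minn c c)%:R < c%:R * (1 - t) + c%:R * t < (minn c c)%:R + 1
  else c%:R * (1 - t) + c%:R * t == (minn c c)%:R.
  by rewrite eqxx minnn; apply/eqP; ring.
by case: p q => [[]|[i [[]|]]] [[]|[j [[]|]]] //= /eqP ->;
  do ?[apply: vertical | move=> ?; apply: vertical | apply: slanted; lia].
Qed.

Lemma open_edge_height p q (t : R) : strip_arrow p q -> 0 < t < 1 ->
  -1 < edge_height p q t < 1.
Proof.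
move=> /arrow_height pq t01; rewrite /edge_height.
have := height_le1 p; have := height_le1 q.
move: (height p) (height q) pq => a b /eqP ? *.
have [?|?] := ltP a b; first by nra.
have ? : b < a by lra.
nra.
Qed.

(** The abscissa of a common point reveals the column and whether the edges are slanted; distinct
    edges agreeing in both occupy disjoint open intervals of heights. *)
Lemma open_edge_inj p q x y (t t' : R) :
  strip_arrow p q -> strip_arrow x y -> 0 < t < 1 -> 0 < t' < 1 ->
  edge_path p q t = edge_path x y t' -> p = x /\ q = y.
Proof.
move=> pq xy ht ht' /(pinch_inj (open_edge_height pq ht)) [Es Eh].
have := open_edge_abscissa pq ht; have := open_edge_abscissa xy ht'.
rewrite -Es; move: (edge_abscissa _ _ _) {Es} => s hs hs'.
have cell (b : bool) (c : R) : (if b then c < s < c + 1 else s == c) -> c <= s < c + 1.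
  by case: b => [|/eqP ->]; lra.
have cc := nat_cell_inj (cell _ _ hs') (cell _ _ hs).
have dd : edge_slanted p q = edge_slanted x y.
  move: hs hs'; rewrite cc; case: ifP => _; case: ifP => _ //; [move=> ? /eqP|move=> /eqP + ?]; lra.
move: pq xy cc dd Eh {hs hs'}; rewrite /edge_column /edge_slanted /edge_height.
case: p q => [[]|[i [[]|]]] [//|[j [[]|]]] //=;
case: x y => [[]|[i' [[]|]]] [//|[j' [[]|]]] //= pq xy cc dd Eh;
  try by [exfalso; lia|exfalso; clear pq xy cc dd; lra].
all: by split=> //; congr (inr (_, _)); apply: val_inj => /=; lia.
Qed.

(** Inside a slanted edge no abscissa is an integer, and a vertical edge joins consecutive heights
    of its column. *)
Lemma open_edge_not_vertex p q w (t : R) : strip_arrow p q -> 0 < t < 1 ->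
  edge_path p q t <> strip_pos w.
Proof.
move=> pq ht /(pinch_inj (open_edge_height pq ht)) [Es Eh].
have := open_edge_abscissa pq ht; rewrite Es.
case: ifP => _; first by rewrite natr1 !ltr_nat; lia.
rewrite eqr_nat => /eqP.
move: pq Eh {Es}; rewrite /edge_height /edge_column.
case: p q => [[]|[i [[]|]]] [//|[j [[]|]]] //=;
case: w => [[]|[i' [[]|]]] //= pq Eh Ec;
  try by [exfalso; lia|exfalso; clear pq Ec; lra].
Qed.

Lemma edge_path_cases p q P : (edge_path p q @` `[0, 1]) P ->
  [\/ P = strip_pos p, P = strip_pos q |
     exists2 t, 0 < t < 1 & P = edge_path p q t].
Proof.
case=> t /=; rewrite in_itv /= => /andP[t0 t1] <-.
have [->|tn0] := eqVneq t 0; first by rewrite edge_path0; constructor 1.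
have [->|tn1] := eqVneq t 1; first by rewrite edge_path1; constructor 2.
by constructor 3; exists t => //; rewrite !lt_neqAle t0 t1 tn1 eq_sym tn0.
Qed.

Lemma strip_planar : planar R (strip n).
Proof.
exists strip_pos, strip_arc; split.
- exact: strip_pos_inj.
- move=> u v /orP[uv|vu].
    rewrite strip_arcE // -(edge_path0 u v) -(edge_path1 u v).
    by apply: arc_between_path; [exact: edge_path_continuous|exact: edge_path_inj].
  rewrite finset.setUC strip_arcE // -(edge_path0 v u) -(edge_path1 v u).
  by apply: arc_between_path_rev; [exact: edge_path_continuous|exact: edge_path_inj].
- move=> u v w _ [p [q [pq uvpq]]] /edge_path_cases w_cases.
  have : w \in [set u; v]%SET.
    rewrite uvpq; case: w_cases => [/strip_pos_inj ->|/strip_pos_inj ->|[t ht]].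
    + exact: set21.
    + exact: set22.
    + by move/esym/(open_edge_not_vertex pq ht).
  by move=> /set2P.
- move=> u v x y _ _ ne P [[p [q [pq uvpq P1]]] [p' [q' [pq' xypq P2]]]].
  case: (edge_path_cases P1) => [->|->|[t ht Pt]]; [by exists p|by exists q|].
  case: (edge_path_cases P2) => [->|->|[t' ht' Pt']]; [by exists p'|by exists q'|].
  case: ne; rewrite uvpq xypq.
  by have [-> ->] := open_edge_inj pq pq' ht ht' (etrans (esym Pt) Pt').
Qed.

End Drawing.

(** * Counting colours on a triangle beside the middle vertex *)

Section Gadget.
Local Open Scope fset_scope.

Lemma card_fsetU_disjoint (C : choiceType) (A B : {fset C}) :
  [disjoint A & B] -> #|` A `|` B| = (#|` A| + #|` B|)%N.
Proof. by move=> dAB; apply/eqP; rewrite leq_card_fsetU. Qed.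

(** The sets [X \ P], [Y], [Z] are pairwise disjoint inside [(W \ P) U E]; the rest of [X] lies in
    [P], hence avoids [E] and falls into [D]. *)
Lemma triangle_overlap (C : choiceType) (X Y Z W D E P : {fset C}) :
  P `<=` W -> D `<=` W -> [disjoint W & E] ->
  X `<=` E `|` D -> Y `<=` W `|` E -> Z `<=` W `|` E ->
  [disjoint X & Y] -> [disjoint X & Z] -> [disjoint Y & Z] ->
  [disjoint Y & P] -> [disjoint Z & P] ->
  (#|` X| + #|` Y| + #|` Z| + #|` P| <= #|` W| + #|` E| + #|` P `&` D|)%N.
Proof.
move=> PW DW WE XED YWE ZWE XY XZ YZ YP ZP.
have sub : (X `\` P) `|` (Y `|` Z) `<=` (W `\` P) `|` E.
  apply/fsubsetP => c; move/fsubsetP/(_ c): DW; move/fsubsetP/(_ c): XED.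
  move/fsubsetP/(_ c): YWE; move/fsubsetP/(_ c): ZWE.
  move/fdisjointP/(_ c): YP; move/fdisjointP/(_ c): ZP.
  rewrite !inE.
  by case: (c \in X); case: (c \in Y); case: (c \in Z); case: (c \in P);
     case: (c \in W); case: (c \in E); case: (c \in D) => //=; auto.
have subP : X `&` P `<=` P `&` D.
  apply/fsubsetP => c; move/fsubsetP/(_ c): PW; move/fsubsetP/(_ c): XED.
  move/fdisjointP/(_ c): WE; rewrite !inE.
  by case: (c \in X); case: (c \in P); case: (c \in W); case: (c \in E);
     case: (c \in D) => //=; auto.
have := fsubset_leq_card sub; have := fsubset_leq_card subP.
have WPE : [disjoint W `\` P & E] by apply: fdisjointWl WE; exact: fsubsetDl.
have XPYZ : [disjoint X `\` P & Y `|` Z].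
  by apply: (@fdisjointWl _ _ X); rewrite ?fdisjointXU ?XY ?XZ // fsubsetDl.
rewrite !card_fsetU_disjoint // !cardfsD (fsetIidPr PW).
have := fsubset_leq_card (fsubsetIl X P); have := fsubset_leq_card PW.
move: #|` X `&` P| #|` P `&` D| #|` X| #|` Y| #|` Z| #|` P| #|` W| #|` E|.
clear; lia.
Qed.

(** * Lists built from intervals of natural numbers *)

Definition colours (p n : nat) : {fset nat} := [fset c in iota p n].

Lemma in_colours p n c : (c \in colours p n) = (p <= c < p + n)%N.
Proof. by rewrite in_fset mem_iota. Qed.

Lemma card_colours p n : #|` colours p n| = n.
Proof. by rewrite card_fseq undup_id ?iota_uniq ?size_iota. Qed.

Lemma sub_colours p n p' n' :
  (p' <= p)%N -> (p + n <= p' + n')%N -> colours p n `<=` colours p' n'.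
Proof. by move=> *; apply/fsubsetP => c; rewrite !in_colours; lia. Qed.

Lemma disjoint_colours p n p' n' :
  (p + n <= p')%N -> [disjoint colours p n & colours p' n'].
Proof. by move=> *; apply/fdisjointP => c; rewrite !in_colours; lia. Qed.

Definition subsets_of_size (C : choiceType) (m : nat) (S : {fset C}) : seq {fset C} :=
  [seq A <- enum_fset (fpowerset S) | #|` A| == m].

Lemma mem_subsets_of_size (C : choiceType) m (S A : {fset C}) :
  (A \in subsets_of_size m S) = (A `<=` S) && (#|` A| == m).
Proof. by rewrite mem_filter andbC -fpowersetE. Qed.

Variables m k : nat.
Hypothesis k3m : (3 * k < m)%N.

(** [U], [V], [W], [E] are consecutive intervals; [D1] and [D2] are the initial and final segments
    of [W], overlapping in [k] colours. *)
Let a := (4 * m + k)%N.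
Let U := colours 0 a.
Let V := colours a a.
Let W := colours (2 * a) (2 * m + k).
Let D1 := colours (2 * a) (m + k).
Let D2 := colours (2 * a + m) (m + k).
Let E := colours (2 * a + 2 * m + k) m.

Let choices := [seq (A, B) | A <- subsets_of_size m U, B <- subsets_of_size m V].
(** The default is itself an admissible pair, so [choice_atP] holds for every [t]. *)
Let choice_at t := nth (colours 0 m, colours a m) choices t.
Let blocks := (3 * size choices)%N.

Let mem_choices A B :
  ((A, B) \in choices) =
  [&& A `<=` U, #|` A| == m, B `<=` V & #|` B| == m].
Proof.
rewrite andbA -!mem_subsets_of_size.
apply/allpairsP/andP => [[[A' B'] [/= ? ? [-> ->]]]|[? ?]] //.
by exists (A, B).
Qed.

Let choice_atP t :
  [/\ (choice_at t).1 `<=` U, #|` (choice_at t).1| = m,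
      (choice_at t).2 `<=` V & #|` (choice_at t).2| = m].
Proof.
have : choice_at t \in choices.
  have [tlt|tge] := ltnP t (size choices); first exact: mem_nth.
  rewrite /choice_at nth_default // mem_choices !card_colours eqxx.
  by rewrite !sub_colours /a //; clear; lia.
rewrite [choice_at t]surjective_pairing mem_choices.
by move=> /and4P[? /eqP ? ? /eqP ?].
Qed.

(* Blocks [3t], [3t + 1], [3t + 2] serve the [t]-th pair [(A, B)]: their [None]
   vertices are x, w and the x of the other side, and the pairs of blocks [3t] and
   [3t + 1] are the y, z of the two sides. *)
Let strip_list (v : strip blocks) : {fset nat} :=
  match v with
  | inl true => U
  | inl false => V
  | inr (j, None) =>
      let: (A, B) := choice_at (j %/ 3) in
      A `|` B `|` (if (j %% 3 == 1)%N then W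
                   else E `|` (if (j %% 3 == 0)%N then D1 else D2))
  | inr (j, Some true) => (choice_at (j %/ 3)).1 `|` (W `|` E)
  | inr (j, Some false) => (choice_at (j %/ 3)).2 `|` (W `|` E)
  end.

Let UV : [disjoint U & V]. Proof. exact: disjoint_colours. Qed.
Let UW : [disjoint U & W]. Proof. apply: disjoint_colours; lia. Qed.
Let VW : [disjoint V & W]. Proof. apply: disjoint_colours; lia. Qed.
Let UE : [disjoint U & E]. Proof. apply: disjoint_colours; lia. Qed.
Let VE : [disjoint V & E]. Proof. apply: disjoint_colours; lia. Qed.
Let WE : [disjoint W & E]. Proof. apply: disjoint_colours; lia. Qed.
Let D1W : D1 `<=` W. Proof. apply: sub_colours; lia. Qed.
Let D2W : D2 `<=` W. Proof. apply: sub_colours; lia. Qed.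

(** All unions are disjoint, with sizes [2m + (2m + k)] at w, [2m + m + (m + k)] at x and
    [m + (2m + k) + m] at y and z. *)
Let strip_list_size : list_assignment a strip_list.
Proof.
case=> [[]|[j l]]; rewrite /= ?card_colours //.
have [AU Am BV Bm] := choice_atP (j %/ 3).
move: (choice_at _) AU Am BV Bm => [A B] /= AU Am BV Bm.
have WE_A : [disjoint A & W `|` E] by rewrite (fdisjointWl AU) // fdisjointXU UW.
have WE_B : [disjoint B & W `|` E] by rewrite (fdisjointWl BV) // fdisjointXU VW.
have cWE : #|` W `|` E| = (3 * m + k)%N.
  by rewrite card_fsetU_disjoint // !card_colours; clear; lia.
case: l => [[]|]; try by rewrite card_fsetU_disjoint // cWE ?Am ?Bm /a; clear; lia.
have AB : [disjoint A & B] by apply: fdisjointWl AU _; apply: fdisjointWr BV _.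
rewrite card_fsetU_disjoint; last first.
  apply: (@fdisjointWr _ _ (W `|` E)); last by rewrite fdisjointUX WE_A.
  case: ifP => _; first exact: fsubsetUl.
  by rewrite fsetUC; case: ifP => _; rewrite fsetSU.
rewrite card_fsetU_disjoint // Am Bm.
case: ifP => _; first by rewrite card_colours /a; clear; lia.
rewrite card_fsetU_disjoint; first by case: ifP => _; rewrite !card_colours /a; clear; lia.
by rewrite fdisjoint_sym; case: ifP => _; rewrite (fdisjointWl _ WE).
Qed.

(** * No colouring from these lists exists *)

Lemma strip_not_choosable : exists n, ~ choosable (strip n) (4 * m + k)%N m.
Proof.
exists blocks => /(_ _ _ strip_list_size) [phi [[phim phiD] phiL]].
set A := phi (inl true); set B := phi (inl false).
have ABin : (A, B) \in choices.
  by rewrite mem_choices /A /B !phim eqxx (phiL (inl true)) (phiL (inl false)).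
(* The colours of the poles single out the piece whose lists contain exactly these colours. *)
set t := index (A, B) choices.
have tlt : (t < size choices)%N by rewrite index_mem.
have tE : choice_at t = (A, B) by exact: nth_index.
have b0 : (3 * t < blocks)%N by rewrite /blocks; move: tlt; clear; lia.
have b1 : (3 * t + 1 < blocks)%N by rewrite /blocks; move: tlt; clear; lia.
have b2 : (3 * t + 2 < blocks)%N by rewrite /blocks; move: tlt; clear; lia.
pose v0 l : strip blocks := inr (Ordinal b0, l).
pose v1 l : strip blocks := inr (Ordinal b1, l).
pose v2 l : strip blocks := inr (Ordinal b2, l).
have d0 : (3 * t) %/ 3 = t by clear; lia.
have d1 : (3 * t + 1) %/ 3 = t by clear; lia.
have d2 : (3 * t + 2) %/ 3 = t by clear; lia.
have r0 : (3 * t) %% 3 = 0%N by clear; lia.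
have r1 : (3 * t + 1) %% 3 = 1%N by clear; lia.
have r2 : (3 * t + 2) %% 3 = 2 by clear; lia.
have drop (v : strip blocks) (S T : {fset nat}) :
    phi v `<=` S `|` T -> [disjoint phi v & S] -> phi v `<=` T.
  move=> sub dis; apply/fsubsetP => c cv.
  by have := fsubsetP sub c cv; rewrite inE (negbTE (fdisjointP dis c cv)).
have adjD u v : strip_adj u v -> [disjoint phi u & phi v] by exact: phiD.
have dA j l : l != Some false -> [disjoint phi (inr (j, l)) & A].
  by case: l => [[]|] // _; apply: adjD.
have dB j l : l != Some true -> [disjoint phi (inr (j, l)) & B].
  by case: l => [[]|] // _; apply: adjD.
have dAB j : [disjoint phi (inr (j, None)) & A `|` B].
  by rewrite fdisjointXU dA ?dB.
have := phiL (v0 None); rewrite /= d0 r0 tE /= => /drop/(_ (dAB _)) X0.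
have := phiL (v1 None); rewrite /= d1 r1 tE /= => /drop/(_ (dAB _)) PW.
have := phiL (v2 None); rewrite /= d2 r2 tE /= => /drop/(_ (dAB _)) X2.
have := phiL (v0 (Some true)); rewrite /= d0 tE /= => /drop/(_ (dA _ (Some true) isT)) Z0.
have := phiL (v1 (Some true)); rewrite /= d1 tE /= => /drop/(_ (dA _ (Some true) isT)) Z1.
have := phiL (v0 (Some false)); rewrite /= d0 tE /= => /drop/(_ (dB _ (Some false) isT)) Y0.
have := phiL (v1 (Some false)); rewrite /= d1 tE /= => /drop/(_ (dB _ (Some false) isT)) Y1.
have a01 b : strip_adj (v0 (Some b)) (v1 None) by case: b; rewrite /strip_adj /= addn1 eqxx.
have a12 b : strip_adj (v2 None) (v1 (Some b)).
  by case: b; rewrite /strip_adj /= addn1 addn2 eqxx orbT.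
have aN (j : 'I_blocks) b : strip_adj (inr (j, None)) (inr (j, Some b)) by rewrite /strip_adj /= eqxx.
have aS (j : 'I_blocks) : strip_adj (inr (j, Some false)) (inr (j, Some true)).
  by rewrite /strip_adj /= eqxx.
(* This amounts to [m - k <= |P n D1|]. *)
have T1 := triangle_overlap PW D1W WE X0 Y0 Z0
  (adjD _ _ (aN _ _)) (adjD _ _ (aN _ _)) (adjD _ _ (aS _))
  (adjD _ _ (a01 _)) (adjD _ _ (a01 _)).
have dP b : [disjoint phi (v1 (Some b)) & phi (v1 None)].
  by rewrite fdisjoint_sym; apply: adjD (aN _ _).
(* The mirror image: here y and z share their block with w, and x is in the next one. *)
have T2 := triangle_overlap PW D2W WE X2 Y1 Z1
  (adjD _ _ (a12 _)) (adjD _ _ (a12 _)) (adjD _ _ (aS _)) (dP _) (dP _).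
move: T1 T2; rewrite !phim !card_colours.
set P := phi _.
have D12 : #|` D1 `&` D2| = k.
  have -> : D1 `&` D2 = colours (2 * a + m) k.
    by apply/fsetP => c; rewrite inE !in_colours; clear; lia.
  exact: card_colours.
(* Inclusion-exclusion inside [P] bounds the sum of the two overlaps by [m + k]. *)
have := cardfsUI (P `&` D1) (P `&` D2).
have : (#|` P `&` D1 `|` P `&` D2| <= m)%N.
  rewrite -(phim (v1 None)); apply: fsubset_leq_card.
  by rewrite fsubUset !fsubsetIl.
have : (#|` P `&` D1 `&` (P `&` D2)| <= k)%N.
  by rewrite -D12; apply: fsubset_leq_card; rewrite fsetISS ?fsubsetIr.
move: #|` _ `|` _| #|` _ `&` (_ `&` _)| #|` _ `&` D1| #|` _ `&` D2|.
clear -k3m; lia.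
Qed.

End Gadget.

Theorem theorem1 (R : realType) (m : nat) (hm : (0 < m)%N) :
  exists G : sgraph,
    planar R G /\ ~ choosable G (4 * m + (2 * m - 1) %/ 9)%N m.
Proof.
(* The quotient k satisfies [9k <= 2m - 1 < 3m]. *)
have k3m : (3 * ((2 * m - 1) %/ 9) < m)%N by lia.
have [n not_choosable] := strip_not_choosable k3m.
by exists (strip n); split; [exact: strip_planar|].
Qed.
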